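(* Let $n\ge 1$ and let $\mathrm{Fl} = \{\mathrm{fl}_1,\dots,\mathrm{fl}_n\}$ and $\mathrm{R} = \{\mathrm{r}_0,\dots,\mathrm{r}_n\}$ be tuples of functions which round to nearest in an IEEE system with unit roundoff $u$. If $20 n u\leq 1$ and $\mathbf{x},\mathbf{y}\in\mathbb{R}^{n+1}$, then $$\left| \mathrm{dot}_{\mathrm{Fl},\mathrm{R}}\left(\sum_{k=0}^n x_k y_k\right) - \sum_{k=0}^n x_k y_k\right| \leq 1.05\,(n+1)\frac{\alpha}{2} + \beta_n u\sum_{k=0}^n |x_k y_k|,$$ where $\beta_n := \dfrac{n+1+3nu}{1+(n+1)u+nu^2}$. If, additionally, $u\sum_{k=0}^n|x_ky_k|\geq\alpha$, then $$\left| \mathrm{dot}_{\mathrm{Fl},\mathrm{R}}\left(\sum_{k=0}^n x_k y_k\right) - \sum_{k=0}^n x_k y_k\right| \leq \frac{3}{2}(n+1)u\sum_{k=0}^n |x_k y_k|.$$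
   Context: Let $\beta \ge 2$ be an integer (the base; not to be confused with the numbers $\beta_n$ of the claim) and $\mu \ge 1$ an integer. The unit roundoff is $u := 1/(2\beta^{\mu})$. For $e\in\mathbb{Z}$ let $\mathcal{E}_e := \{\beta^e(\beta^\mu + r) : r = 0,1,\dots,(\beta-1)\beta^\mu - 1\}$. For an integer $e_\alpha < -\mu$ let $\mathcal{S}_{e_\alpha} := \{\beta^{e_\alpha} r : r = 1,\dots,\beta^\mu-1\}$. The IEEE system associated to $\beta,\mu,e_\alpha$ is $\mathcal{I} := \{0\}\cup \mathcal{S}_{e_\alpha}\cup -\mathcal{S}_{e_\alpha} \cup \bigcup_{e\ge e_\alpha} (\mathcal{E}_e \cup -\mathcal{E}_e)$, and for it $\alpha := \beta^{e_\alpha}$. A function $\mathrm{fl}:\mathbb{R}\to\mathbb{R}$ rounds to nearest in a system $\mathcal{F}$ if for all $z\in\mathbb{R}$ one has $\mathrm{fl}(z)\in\mathcal{F}$ and $|\mathrm{fl}(z)-z|\le|x-z|$ for all $x\in\mathcal{F}$ (ties may be broken arbitrarily). A tuple rounds to nearest in $\mathcal{F}$ if each of its elements does (the elements may differ). Floating point sum: for real $p_0,\dots,p_n$, put $\hat s_1 := \mathrm{fl}_1(p_0+p_1)$ and $\hat s_k := \mathrm{fl}_k(\hat s_{k-1}+p_k)$ for $2\le k\le n$. Then $\mathrm{Fl}\left(\sum_{k=0}^n p_k\right) := \hat s_n$. Floating point dot product: $\mathrm{dot}_{\mathrm{Fl},\mathrm{R}}\left(\sum_{k=0}^n x_ky_k\right)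 := \mathrm{Fl}\left(\sum_{k=0}^n \mathrm{r}_k(x_ky_k)\right)$. *)

(* Defs.v *)
From mathcomp Require Export all_boot all_order all_algebra.
From mathcomp Require Export classical_sets reals.

Import Order.TTheory GRing.Theory Num.Theory.
Local Open Scope classical_set_scope.
Local Open Scope ring_scope.

Definition unit_roundoff (R : realType) (beta mu : nat) : R :=
  1 / (2 * beta%:R ^+ mu).

Definition alpha (R : realType) (beta : nat) (ea : int) : R := beta%:R ^ ea.

(* E_e : the positive normal numbers with exponent e. *)
Definition normal_pos (R : realType) (beta mu : nat) (e : int) : set R :=
  [set x | exists2 r : nat, (r < (beta - 1) * beta ^ mu)%N &
     x = beta%:R ^ e * (beta%:R ^+ mu + r%:R)].

(* S_ea : the positive subnormal numbers. *)
Definition subnormal_pos (R : realType) (beta mu : nat) (ea : int) : set R :=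
  [set x | exists2 r : nat, (1 <= r < beta ^ mu)%N & x = beta%:R ^ ea * r%:R].

(* There is no largest exponent, hence no overflow. *)
Definition ieee_system (R : realType) (beta mu : nat) (ea : int) : set R :=
  [set 0] `|` subnormal_pos R beta mu ea `|` -%R @` subnormal_pos R beta mu ea
  `|` \bigcup_(e in [set e : int | ea <= e])
        (normal_pos R beta mu e `|` -%R @` normal_pos R beta mu e).

Definition rounds_to_nearest {R : realType} (F : set R) (fl : R -> R) : Prop :=
  forall z : R, F (fl z) /\ (forall x : R, F x -> `|fl z - z| <= `|x - z|).

(* Indices are shifted: [fl k] with k : 'I_n is the rounding function fl_(k+1),
   and [p (lift ord0 k)] is p_(k+1).  The fold computes
   s_0 = p_0 and s_(k+1) = fl_(k+1) (s_k + p_(k+1)); it returns s_n. *)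
Definition Fl_sum {R : realType} {n : nat} (fl : 'I_n -> R -> R)
    (p : 'I_n.+1 -> R) : R :=
  foldl (fun s k => fl k (s + p (lift ord0 k))) (p ord0) (enum 'I_n).

Definition Fl_dot {R : realType} {n : nat} (fl : 'I_n -> R -> R)
    (r : 'I_n.+1 -> R -> R) (x y : 'rV[R]_n.+1) : R :=
  Fl_sum fl (fun k => r k (x 0 k * y 0 k)).

Definition beta_coef {R : realType} (n : nat) (u : R) : R :=
  (n%:R + 1 + 3 * n%:R * u) / (1 + (n%:R + 1) * u + n%:R * u ^+ 2).

(* Main.v *)
Require Import Defs.
From mathcomp Require Import zify ring lra.

(** Write [z_k] for the products, [q_k] for their rounded values, and put
    [theta := nu / (1 + nu)] and [eps := u / (1 + u)].

    Rounding one number costs at most [eps |z|] in the normal range and at most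
    [alpha / 2] in the subnormal range ([fl_error]).  Summing [n + 1] floating
    point numbers costs at most [theta] times the sum of their absolute values
    ([sum_error]), and no underflow term appears there: floating point numbers
    are integer multiples of [alpha], so an addition with a subnormal result is
    exact.  Composing the two gives the relative coefficient
    [eps + theta (1 + eps)], which is [beta_coef n u * u] ([beta_coefE]), and
    the absolute term [(1 + theta) (n + 1) alpha / 2] ([dot_error]).  Both
    halves of the theorem follow: [theta <= 1/20] gives the first, and
    [beta_coef n u <= (n + 1) (1 - theta / 2)] ([beta_coef_le]) the second.

    The heart is the sharp constant [theta] in place of the compounded
    [(1 + eps)^n - 1].  Let [t_i] be the exact value of the [i]-th addition,
    [delta_i] its rounding error, [D] the sum of the [|delta_i|], [M] the sum of
    the absolute values of the summands, and [B] the largest power of the base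
    reached by some [|t_i|].  No [delta_i] exceeds [uB], so [D <= nuB], which
    settles the case [M >= (1 + nu) B].  When [M] is smaller,
    reaching [B] has used up most of [M]: at the first [k] with [|t_k| >= B] the
    error is at most [|t_k| - B], because [B] is itself a floating point
    number, and a later error is at most the summand just added, because not
    adding it was possible too.  The errors before [k] may have inflated
    [|t_k|], but they occur in lower binades and are at most [uB / 2] each.  So
    [D] obeys two bounds, one increasing and one decreasing in [k], and a convex
    combination of them eliminates [k] ([perturbed_sum_bound]). *)

Set Implicit Arguments.
Unset Strict Implicit.
Unset Printing Implicit Defensive.

Import Order.TTheory GRing.Theory Num.Theory.
Local Open Scope classical_set_scope.
Local Open Scope ring_scope.

(** * The coefficient of the relative error *)

(** The denominator of [beta_coef] is [(1 + u) (1 + nu)]: the coefficient is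
    the error of one product followed by that of [n] additions. *)
Lemma beta_coefE (R : realType) (n : nat) (u : R) : 0 <= u ->
  beta_coef n u * u =
    u / (1 + u) + n%:R * u / (1 + n%:R * u) * (1 + u / (1 + u)).
Proof.
move=> u0; rewrite /beta_coef.
have -> : 1 + (n%:R + 1) * u + n%:R * u ^+ 2 = (1 + u) * (1 + n%:R * u) :> R.
  by ring.
by field; rewrite !gt_eqF ?ltr_wpDr // mulr_ge0.
Qed.

(** The gap [theta / 2] pays for the factor [1 + theta] by which the additions
    amplify the underflow errors of the products.  After clearing denominators
    the first-order terms in [u] leave [n^2 - 3 n + 2 >= 0]: this is true for
    integers, but false for reals strictly between 1 and 2. *)
Lemma beta_coef_le (R : realType) (n : nat) (u : R) : (1 <= n)%N -> 0 <= u ->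
  beta_coef n u <= (n%:R + 1) * (1 - n%:R * u / (1 + n%:R * u) / 2).
Proof.
move=> n1 u0; have nu0 : 0 <= n%:R * u by rewrite mulr_ge0.
have nu1 : 0 < 1 + n%:R * u by rewrite ltr_wpDr.
rewrite /beta_coef.
have -> : 1 + (n%:R + 1) * u + n%:R * u ^+ 2 = (1 + u) * (1 + n%:R * u) :> R.
  by ring.
rewrite ler_pdivrMr ?mulr_gt0 // ?ltr_wpDr //.
have -> : (n%:R + 1) * (1 - n%:R * u / (1 + n%:R * u) / 2) * ((1 + u) * (1 + n%:R * u)) =
    (n%:R + 1) * (2 + n%:R * u) * (1 + u) / 2 :> R.
  by field; rewrite gt_eqF.
have n12 : 0 <= (n%:R - 1) * (n%:R - 2) :> R.
  case: n n1 {nu0 nu1} => [|[|n]] // _; first by rewrite subrr mul0r.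
  by rewrite mulr_ge0 ?subr_ge0 ?ler1n ?ler_nat.
have := mulr_ge0 u0 n12.
have : 0 <= (n%:R + 1) * (n%:R * u) * u by rewrite !mulr_ge0 ?addr_ge0.
by lra.
Qed.

(** * Sums with perturbed additions *)

(** With [v = nu]: [D <= vB] suffices when [M >= (1 + v) B], and below this
    threshold the second bound is the smaller one, and what it leaves to prove
    is [(1 - 2 v) ((1 + v) B - M) >= 0]. *)
Lemma budget_balance (R : realFieldType) (v B D M : R) :
  0 <= v -> 2 * v <= 1 -> D <= v * B -> 3 * D <= M - B + 2 * (v * B) ->
  (1 + v) * D <= v * M.
Proof.
move=> v0 v1 D1 D3; have [BM|MB] := leP ((1 + v) * B) M.
- have : 0 <= v * (M - (1 + v) * B) by rewrite mulr_ge0 ?subr_ge0.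
  have : 0 <= (1 + v) * (v * B - D) by rewrite mulr_ge0 ?subr_ge0 ?addr_ge0.
  by lra.
- have : 0 <= (1 - 2 * v) * ((1 + v) * B - M) by rewrite mulr_ge0 ?subr_ge0 // ltW.
  have : 0 <= (1 + v) * (M - B + 2 * (v * B) - 3 * D).
    by rewrite mulr_ge0 ?subr_ge0 ?addr_ge0.
  by lra.
Qed.

(** [B] stands for the leading power of the base of the largest [|t i|]; the
    four bounds on [delta] are what rounding to nearest provides at that scale.
    Splitting the errors at the first [k] with [B <= |t k|] gives two bounds on
    their sum that move in opposite directions as [k] grows. *)
Lemma perturbed_sum_bound (R : realFieldType) (n : nat) (s p : nat -> R) (u B : R) :
  let t i := s i + p i.+1 in
  let delta i := s i.+1 - t i in
  0 <= u -> 0 <= B -> 2 * (n%:R * u) <= 1 -> s 0%N = p 0%N ->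
  (forall i, (i < n)%N -> `|delta i| <= `|p i.+1|) ->
  (forall i, (i < n)%N -> `|delta i| <= u * B) ->
  (forall i, (i < n)%N -> `|t i| < B -> `|delta i| <= u * B / 2) ->
  (forall i, (i < n)%N -> B <= `|t i| -> `|delta i| <= `|t i| - B) ->
  (exists2 i, (i < n)%N & B <= `|t i|) ->
  (1 + n%:R * u) * (\sum_(0 <= i < n) `|delta i|) <=
    n%:R * u * \sum_(0 <= i < n.+1) `|p i|.
Proof.
move=> t delta u0 B0 nu s0 dp du dsmall dbig [j jn tj].
have [k /andP[kn tk] kmin] : exists2 k, (k < n)%N && (B <= `|t k|) &
    forall i, (i < n)%N && (B <= `|t i|) -> (k <= i)%N.
  have ex : exists i, (i < n)%N && (B <= `|t i|) by exists j; rewrite jn.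
  by case: (ex_minnP ex) => k; exists k.
have before : \sum_(0 <= i < k) `|delta i| <= k%:R * (u * B / 2).
  rewrite mulr_natl -[in leRHS](subn0 k) -sumr_const_nat.
  apply: ler_sum_nat => i /andP[_ ik]; apply: dsmall; first exact: ltn_trans kn.
  rewrite ltNge; apply/negP => ti.
  by have := kmin i; rewrite ti (ltn_trans ik kn) leqNgt ik => /(_ isT).
have after : \sum_(k <= i < n) `|delta i| <= (n%:R - k%:R) * (u * B).
  rewrite -natrB 1?ltnW // mulr_natl -sumr_const_nat.
  by apply: ler_sum_nat => i /andP[_]; exact: du.
have drift m : `|s m| <= \sum_(0 <= i < m.+1) `|p i| + \sum_(0 <= i < m) `|delta i|.
  elim: m => [|m IH]; first by rewrite big_nat1 big_geq // addr0 s0.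
  rewrite big_nat_recr // [X in _ <= _ + X]big_nat_recr //=.
  have -> : s m.+1 = s m + p m.+1 + delta m by rewrite /delta /t addrC subrK.
  by have := ler_normD (s m + p m.+1) (delta m); have := ler_normD (s m) (p m.+1); lra.
(* [k] pays with the excess of [|t k|] over [B], every later step with the
   summand it adds. *)
have tail : \sum_(k <= i < n) `|delta i| <= `|t k| - B + \sum_(k.+2 <= i < n.+1) `|p i|.
  rewrite big_ltn // [X in _ <= _ + X]big_add1 /= lerD ?dbig //.
  by apply: ler_sum_nat => i /andP[_]; exact: dp.
have tk_le : `|t k| <= \sum_(0 <= i < k.+2) `|p i| + \sum_(0 <= i < k) `|delta i|.
  rewrite big_nat_recr //= addrAC.
  by apply: le_trans (ler_normD _ _) _; rewrite lerD2r.
have Dsplit : \sum_(0 <= i < n) `|delta i| =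
  \sum_(0 <= i < k) `|delta i| + \sum_(k <= i < n) `|delta i|.
  by rewrite (@big_cat_nat _ _ _ k) //= ltnW.
have Msplit : \sum_(0 <= i < n.+1) `|p i| =
  \sum_(0 <= i < k.+2) `|p i| + \sum_(k.+2 <= i < n.+1) `|p i|.
  by rewrite (@big_cat_nat _ _ _ k.+2).
set D := \sum_(0 <= i < n) _ in Dsplit *; set M := \sum_(0 <= i < n.+1) _ in Msplit *.
have kuB : 0 <= k%:R * (u * B) by rewrite !mulr_ge0.
have D1 : D <= n%:R * u * B by clear -before after Dsplit kuB; lra.
(* The weights 1 and 2 of the two bounds on [D] make the [k u B] terms cancel:
   [D <= M - B + k u B] and [D <= n u B - k u B / 2]. *)
have D3 : 3 * D <= M - B + 2 * (n%:R * u * B).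
  by clear -before after Dsplit tail tk_le Msplit; lra.
apply: budget_balance D1 D3 => //; exact: mulr_ge0.
Qed.

(** * Partial sums *)

(** Exposes the partial sums, so that the fold can be treated as a recurrence. *)
Lemma Fl_sumE (R : realType) (n : nat) (fl : 'I_n -> R -> R) (p : 'I_n.+1 -> R) :
  exists s : nat -> R, [/\ s 0%N = p ord0, Fl_sum fl p = s n &
    forall k : 'I_n, s k.+1 = fl k (s k + p (lift ord0 k))].
Proof.
set f := fun s k => fl k (s + p (lift ord0 k)).
exists (fun i => foldl f (p ord0) (take i (enum 'I_n))); split => //.
- by rewrite take0.
- by rewrite take_oversize // size_enum_ord.
- by move=> k; rewrite (take_nth k) ?size_enum_ord // foldl_rcons nth_ord_enum.
Qed.

(** * The floating point grid *)

Section Grid.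
Variables (R : realType) (beta mu : nat) (ea : int).
Hypothesis beta_ge2 : (2 <= beta)%N.
Local Notation F := (ieee_system R beta mu ea).
Local Notation b := (beta%:R : R).
Local Notation a := (alpha R beta ea).
Local Notation u := (unit_roundoff R beta mu).

Lemma b_ge2 : 2 <= b.
Proof. by rewrite ler_nat. Qed.

Lemma b_gt0 : 0 < b.
Proof. by rewrite (lt_le_trans _ b_ge2). Qed.

Lemma a_gt0 : 0 < a.
Proof. by rewrite exprz_gt0 // b_gt0. Qed.

Lemma bn_gt0 d : 0 < b ^+ d.
Proof. by rewrite exprn_gt0 // b_gt0. Qed.

Lemma u_gt0 : 0 < u.
Proof. by rewrite divr_gt0 // mulr_gt0 // bn_gt0. Qed.

Lemma alphaXn d : a * b ^+ d = b ^ (ea + d%:Z).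
Proof. by rewrite /alpha expfzDr // gt_eqF // b_gt0. Qed.

Lemma ieeeN x : F x -> F (- x).
Proof.
move=> [[[->|Sx]|[y Sy <-]]|[e ee [Ex|[y Ey <-]]]].
- by rewrite oppr0; left; left; left.
- by left; right; exists x.
- by rewrite opprK; left; left; right.
- by right; exists e => //; right; exists x.
- by rewrite opprK; right; exists e => //; left.
Qed.

Lemma ieee_multiple x : F x -> exists m : int, x = a * m%:~R.
Proof.
have normal e y : ea <= e -> normal_pos R beta mu e y -> exists m : int, y = a * m%:~R.
  move=> ee [r _ ->].
  exists ((beta ^ `|e - ea| * (beta ^ mu + r))%N%:Z).
  have -> : e = ea + `|e - ea|%N%:Z by lia.
  rewrite -alphaXn -pmulrn natrM natrX natrD natrX mulrA.
  by rewrite [ea + _]addrC addrK absz_nat.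
have subn y : subnormal_pos R beta mu ea y -> exists m : int, y = a * m%:~R.
  by move=> [r _ ->]; exists r%:Z.
have opp y : (exists m : int, y = a * m%:~R) -> exists m : int, - y = a * m%:~R.
  by move=> [m ->]; exists (- m); rewrite rmorphN mulrN.
move=> [[[->|Sx]|[y Sy <-]]|[e ee [Ex|[y Ey <-]]]].
- by exists 0; rewrite mulr0.
- exact: subn.
- exact/opp/subn.
- exact: normal Ex.
- exact/opp/(normal e).
Qed.

(** Conversely to [ieee_multiple], the multiples of [a b^d] are representable
    as far as [a b^d b^(mu + 1)].  The upper end opens the next binade; a
    multiplier below [b^mu] is rescaled by [b] until it is normalised or the
    exponent is the smallest one, where it is subnormal. *)
Lemma ieee_grid d (m : int) : (`|m| <= beta ^ mu.+1)%N -> F (a * b ^+ d * m%:~R).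
Proof.
wlog m0 : m / 0 <= m.
  move=> H; case: (leP 0 m) => [/H//|/ltW m0] mb.
  rewrite -[m]opprK rmorphN mulrN; apply/ieeeN/H; lia.
case: m m0 => // m _; rewrite absz_nat => mb.
have normal d' k : (beta ^ mu <= k <= beta ^ mu.+1)%N -> F (a * b ^+ d' * (Posz k)%:~R).
  move=> /andP[kge]; rewrite leq_eqVlt => /orP[/eqP->|klt].
  - right; exists (ea + d'.+1%:Z); first by rewrite /=; lia.
    left; exists 0%N; first by rewrite muln_gt0 expn_gt0; lia.
    by rewrite -alphaXn -pmulrn natrX addr0 !exprS; ring.
  - right; exists (ea + d'%:Z); first by rewrite /=; lia.
    left; exists (k - beta ^ mu)%N; first by rewrite mulnBl mul1n -expnS; lia.
    by rewrite -alphaXn -pmulrn natrB // natrX addrC subrK.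
elim: d m mb => [|d IH] m mb; have [mlt|mge] := ltnP m (beta ^ mu).
- case: m mlt {mb} => [|m] mlt; first by rewrite mulr0; left; left; left.
  by left; left; right; exists m.+1; rewrite // mulr1.
- by apply: normal; rewrite mge.
- rewrite exprSr -mulrA -mulrA.
  have -> : b * (Posz m)%:~R = (Posz (beta * m)%N)%:~R :> R by rewrite -!pmulrn natrM.
  by rewrite mulrA; apply: IH; rewrite expnS leq_mul2l ltnW ?orbT.
- by apply: normal; rewrite mge.
Qed.

Lemma beta_pow_unbounded (z : R) : exists d, `|z| < a * b ^+ mu * b ^+ d.
Proof.
have A0 : 0 < a * b ^+ mu by rewrite mulr_gt0 ?a_gt0 ?bn_gt0.
exists (Num.bound (`|z| / (a * b ^+ mu))).
rewrite -ltr_pdivrMl // mulrC.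
apply: lt_le_trans (upper_nthrootP (leqnn _)) _.
by rewrite lerXn2r ?nnegrE ?b_ge2 // ltW ?b_gt0.
Qed.

(** Finitely many numbers are either all in the subnormal range, or have a
    common largest binade, which one of them reaches. *)
Lemma beta_scale (n : nat) (z : 'I_n -> R) :
  (forall i, `|z i| < a * b ^+ mu) \/
  exists2 d, (forall i, `|z i| < a * b ^+ mu * b ^+ d.+1) &
    exists i, a * b ^+ mu * b ^+ d <= `|z i|.
Proof.
pose P d := [forall i, `|z i| < a * b ^+ mu * b ^+ d].
have exP : exists d, P d.
  have [d dP] := beta_pow_unbounded (\sum_i `|z i|).
  exists d; apply/forallP => i; apply: le_lt_trans dP.
  rewrite [leRHS]ger0_norm ?sumr_ge0 // (bigD1 i) //= lerDl; exact: sumr_ge0.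
case: (ex_minnP exP) => -[|d] /forallP Pd dmin.
  by left => i; rewrite -[ltRHS]mulr1 -(expr0 b).
right; exists d => //; apply/existsP; apply: contraT; rewrite negb_exists => /forallP H.
have := dmin d; rewrite ltnn => /(_ _); rewrite -[false]/(~~ true) => ->//.
by apply/forallP => i; rewrite ltNge.
Qed.

(** * Rounding one number *)

Section Rounding.
Variable fl : R -> R.
Hypothesis fl_nearest : rounds_to_nearest F fl.

Lemma fl_ieee z : F (fl z).
Proof. by case: (fl_nearest z). Qed.

Lemma fl_best x z : F x -> `|fl z - z| <= `|x - z|.
Proof. by move=> Fx; case: (fl_nearest z) => _; apply. Qed.

(** The competitor is the nearest multiple of [a b^d]; it is in range because
    the upper end of the range is itself such a multiple. *)
Lemma fl_error_grid d z : `|z| <= a * b ^+ d * b ^+ mu.+1 ->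
  `|fl z - z| <= a * b ^+ d / 2.
Proof.
move=> zle; set h := a * b ^+ d in zle *.
have h0 : 0 < h by rewrite mulr_gt0 ?a_gt0 ?bn_gt0.
pose m := Num.floor (z / h + 1 / 2).
have zE : z = h * (z / h) by rewrite mulrC divfK // gt_eqF.
have [m1 m2] : m%:~R <= z / h + 1 / 2 /\ z / h + 1 / 2 < m%:~R + 1.
  by rewrite floor_le -[1]/(1%:~R) -rmorphD floorD1_gt.
have Nz : `|z / h| <= (beta ^ mu.+1)%:R.
  by rewrite normrM normfV (gtr0_norm h0) ler_pdivrMr // mulrC natrX.
have mle : (`|m| <= beta ^ mu.+1)%N.
  have [n1 n2] : - (beta ^ mu.+1)%:R <= z / h /\ z / h <= (beta ^ mu.+1)%:R.
    by apply/andP; rewrite -ler_norml.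
  have : (- (beta ^ mu.+1)%N%:Z < m + 1)%R.
    by rewrite -(ltr_int R) rmorphN rmorphD /= -pmulrn; lra.
  have : (m < (beta ^ mu.+1)%N%:Z + 1)%R.
    by rewrite -(ltr_int R) rmorphD /= -pmulrn; lra.
  by lia.
apply: le_trans (fl_best _ (ieee_grid d mle)) _.
rewrite -/h {1}zE -mulrBr normrM (gtr0_norm h0) ler_pM2l // ler_norml.
by apply/andP; split; lra.
Qed.

Lemma fl_error_underflow z : `|z| <= a * b ^+ mu -> `|fl z - z| <= a / 2.
Proof.
move=> zle; have := @fl_error_grid 0 z; rewrite mulr1; apply.
apply: le_trans zle _; rewrite ler_pM2l ?a_gt0 // ler_eXn2l ?(lt_le_trans _ b_ge2) //.
by rewrite ltr1n.
Qed.

(** The number of absolute value [a b^mu b^d] with the sign of [z] competes. *)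
Lemma fl_error_scale d z : a * b ^+ mu * b ^+ d <= `|z| ->
  `|fl z - z| <= `|z| - a * b ^+ mu * b ^+ d.
Proof.
set B := _ * b ^+ d => Bz.
have B0 : 0 < B by rewrite !mulr_gt0 ?a_gt0 ?bn_gt0.
have FB : F B.
  have -> : B = a * b ^+ d * (beta ^ mu)%N%:Z%:~R by rewrite -pmulrn natrX mulrAC.
  by apply: ieee_grid; rewrite leq_exp2l.
have [z0|z0] := leP 0 z.
- apply: le_trans (fl_best _ FB) _.
  by rewrite (ger0_norm z0) in Bz *; rewrite distrC ger0_norm // subr_ge0.
- apply: le_trans (fl_best _ (ieeeN FB)) _.
  by rewrite (ltr0_norm z0) in Bz *; rewrite -opprD normrN ler_norml; lra.
Qed.

Lemma fl_error_ulp d z : `|z| < a * b ^+ mu * b ^+ d.+1 ->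
  `|fl z - z| <= u * (a * b ^+ mu * b ^+ d).
Proof.
move=> /ltW zle; have -> : u * (a * b ^+ mu * b ^+ d) = a * b ^+ d / 2.
  by rewrite /unit_roundoff; field; rewrite gt_eqF ?bn_gt0.
apply: fl_error_grid; apply: le_trans zle _.
rewrite !exprS.
by have -> : a * b ^+ mu * (b * b ^+ d) = a * b ^+ d * (b * b ^+ mu) by ring.
Qed.

(** The sharp [u / (1 + u)], rather than [u], comes from combining the half-ulp
    bound [u B] with the bound [|z| - B], where [B] is the leading power of
    [z]. *)
Lemma fl_error z : `|fl z - z| <= u / (1 + u) * `|z| + a / 2.
Proof.
have u0 := u_gt0; have a0 := a_gt0.
have uu : 0 < u / (1 + u) by rewrite divr_gt0 ?addr_gt0.
case: (beta_scale (fun _ : 'I_1 => z)) => [/(_ ord0) zlt|[d /(_ ord0) zlt [_ zge]]].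
  apply: le_trans (fl_error_underflow (ltW zlt)) _.
  by rewrite lerDr mulr_ge0 // ltW.
have e1 := fl_error_ulp zlt; have e2 := fl_error_scale zge.
rewrite -[leLHS]addr0; apply: lerD; last by rewrite divr_ge0 ?ltW.
rewrite mulrAC ler_pdivlMr ?addr_gt0 //.
have : 0 <= u * (`|z| - a * b ^+ mu * b ^+ d - `|fl z - z|).
  by rewrite mulr_ge0 ?subr_ge0 // ltW.
by clear -e1; lra.
Qed.

Lemma fl_fixed z : F z -> fl z = z.
Proof.
move=> Fz; apply/eqP; rewrite -subr_eq0 -normr_le0.
by apply: le_trans (fl_best _ Fz) _; rewrite subrr normr0.
Qed.

(** Rounding back to [x] is always possible. *)
Lemma fl_add_le x y : F x -> `|fl (x + y) - (x + y)| <= `|y|.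
Proof.
move=> Fx; apply: le_trans (fl_best _ Fx) _.
by rewrite opprD addrA subrr add0r normrN.
Qed.

(** Addition cannot underflow: the exact result is a multiple of [a], and
    every such multiple in the subnormal range is representable. *)
Lemma fl_add_exact x y : F x -> F y -> `|x + y| < a * b ^+ mu -> fl (x + y) = x + y.
Proof.
move=> /ieee_multiple[k ->] /ieee_multiple[l ->].
rewrite -mulrDr -rmorphD /= normrM (gtr0_norm a_gt0) ltr_pM2l ?a_gt0 // => klt.
apply: fl_fixed; have := @ieee_grid 0 (k + l); rewrite mulr1; apply.
have : (`|k + l| < (beta ^ mu)%N%:Z)%R by rewrite -(ltr_int R) intr_norm -pmulrn natrX.
have : (beta ^ mu <= beta ^ mu.+1)%N by rewrite leq_exp2l.
by lia.
Qed.

(** Below a power [B] of the base, the spacing is smaller by a factor [b >= 2];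
    when [B] is the least normal number the addition is exact instead. *)
Lemma fl_add_below d x y : F x -> F y -> `|x + y| < a * b ^+ mu * b ^+ d ->
  `|fl (x + y) - (x + y)| <= u * (a * b ^+ mu * b ^+ d) / 2.
Proof.
have uB e : 0 <= u * (a * b ^+ mu * b ^+ e).
  apply: mulr_ge0; first exact: ltW u_gt0.
  by rewrite !mulr_ge0 // ltW ?a_gt0 ?bn_gt0.
move=> Fx Fy; case: d => [|d] xylt.
  rewrite mulr1 in xylt.
  by rewrite fl_add_exact // subrr normr0 divr_ge0.
apply: le_trans (fl_error_ulp xylt) _.
have : 0 <= u * (a * b ^+ mu * b ^+ d) * (b - 2).
  by rewrite mulr_ge0 ?subr_ge0 ?b_ge2.
by rewrite exprS; lra.
Qed.

End Rounding.

(** * Sums and dot products *)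

(** [perturbed_sum_bound] at the leading binade of the exact values of the
    additions; if they are all subnormal, there is no error. *)
Lemma sum_error (n : nat) (s p : nat -> R) :
  2 * (n%:R * u) <= 1 -> s 0%N = p 0%N ->
  (forall i, (i <= n)%N -> F (p i)) ->
  (forall i, (i < n)%N ->
     exists2 fl, rounds_to_nearest F fl & s i.+1 = fl (s i + p i.+1)) ->
  `|s n - \sum_(0 <= i < n.+1) p i| <=
    n%:R * u / (1 + n%:R * u) * \sum_(0 <= i < n.+1) `|p i|.
Proof.
move=> nu s0 Fp Hfl.
have Fs i : (i < n)%N -> F (s i).
  case: i => [|i] lt_in; first by rewrite s0; apply: Fp.
  by have [fl fl_nearest ->] := Hfl i (ltnW lt_in); exact: fl_ieee.
have nu0 : 0 <= n%:R * u by rewrite mulr_ge0 // ltW // u_gt0.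
have telescope : s n - \sum_(0 <= i < n.+1) p i =
    \sum_(0 <= i < n) (s i.+1 - (s i + p i.+1)).
  elim: n {nu nu0 Fp Hfl Fs} => [|m IH]; first by rewrite big_nat1 big_geq // s0 subrr.
  by rewrite big_nat_recr //= [RHS]big_nat_recr //= -IH; ring.
case: (beta_scale (fun i : 'I_n => s i + p i.+1)) => [small|[d below [j above]]].
  rewrite telescope big_nat big1 => [|i /andP[_ lt_in]].
    by rewrite normr0 mulr_ge0 ?sumr_ge0 // divr_ge0 // addr_ge0.
  have [fl fl_nearest ->] := Hfl i lt_in.
  rewrite (fl_add_exact fl_nearest) ?subrr //; [exact: Fs|exact: Fp|].
  exact: (small (Ordinal lt_in)).
rewrite mulrAC ler_pdivlMr ?ltr_wpDr // mulrC.
apply: (@le_trans _ _ ((1 + n%:R * u) * \sum_(0 <= i < n) `|s i.+1 - (s i + p i.+1)|)).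
  by rewrite telescope ler_wpM2l ?ler_norm_sum // addr_ge0.
apply: (@perturbed_sum_bound _ n s p u (a * b ^+ mu * b ^+ d)) => //.
- exact/ltW/u_gt0.
- by rewrite !mulr_ge0 // ltW ?a_gt0 ?bn_gt0.
- move=> i lt_in; have [fl fl_nearest ->] := Hfl i lt_in.
  exact: fl_add_le (Fs i lt_in).
- move=> i lt_in; have [fl fl_nearest ->] := Hfl i lt_in.
  exact: (fl_error_ulp fl_nearest (below (Ordinal lt_in))).
- move=> i lt_in; have [fl fl_nearest ->] := Hfl i lt_in.
  by apply: fl_add_below => //; [exact: Fs|exact: Fp].
- move=> i lt_in; have [fl fl_nearest ->] := Hfl i lt_in.
  exact: fl_error_scale.
- by exists j.
Qed.

(** The products are rounded to floating point numbers, so [sum_error] applies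
    to them; their own rounding errors enter twice, once directly and once,
    through their absolute values, in the bound for the sum. *)
Lemma dot_error (n : nat) (fl : 'I_n -> R -> R) (r : 'I_n.+1 -> R -> R)
    (z : 'I_n.+1 -> R) :
  2 * (n%:R * u) <= 1 ->
  (forall k, rounds_to_nearest F (fl k)) ->
  (forall k, rounds_to_nearest F (r k)) ->
  `|Fl_sum fl (fun k => r k (z k)) - \sum_k z k| <=
    (1 + n%:R * u / (1 + n%:R * u)) * ((n%:R + 1) * (a / 2)) +
    beta_coef n u * u * \sum_k `|z k|.
Proof.
move=> nu Hfl Hr; set q := fun k => r k (z k).
have u0 := u_gt0.
have nu0 : 0 <= n%:R * u by rewrite mulr_ge0 // ltW.
have sum_q : `|Fl_sum fl q - \sum_k q k| <=
    n%:R * u / (1 + n%:R * u) * \sum_k `|q k|.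
  have [s [s0 -> sS]] := Fl_sumE fl q.
  have reindex (g : 'I_n.+1 -> R) : \sum_(0 <= i < n.+1) g (inord i) = \sum_k g k.
    by rewrite big_mkord; apply: eq_bigr => i _; rewrite inord_val.
  have := @sum_error n s (fun i => q (inord i)) nu.
  rewrite /= (reindex q) (reindex (fun k => `|q k|)); apply.
  - by rewrite s0; congr q; apply/val_inj; rewrite /= inordK.
  - by move=> i _; exact: fl_ieee.
  - move=> i lt_in; exists (fl (Ordinal lt_in)) => //.
    rewrite (sS (Ordinal lt_in)) /=; congr (fl _ (_ + q _)).
    by apply/val_inj; rewrite /= inordK.
pose S : R := \sum_k `|z k|; pose Q : R := \sum_k `|q k|.
rewrite -/S; rewrite -/Q in sum_q.
have round_q : \sum_k `|q k - z k| <= u / (1 + u) * S + (n%:R + 1) * (a / 2).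
  apply: le_trans (ler_sum _ (fun k _ => fl_error (Hr k) (z k))) _.
  by rewrite big_split /= -mulr_sumr sumr_const card_ord natr1 mulr_natl.
have QS : Q <= S + \sum_k `|q k - z k|.
  rewrite -big_split /=; apply: ler_sum => k _.
  by rewrite -{1}[q k](subrK (z k)) addrC ler_normD.
have split_err : `|Fl_sum fl q - \sum_k z k| <=
    `|Fl_sum fl q - \sum_k q k| + \sum_k `|q k - z k|.
  rewrite -[X in `|X|](subrKA (\sum_k q k)) -sumrB.
  by apply: le_trans (ler_normD _ _) _; rewrite lerD2l ler_norm_sum.
rewrite (beta_coefE _ (ltW u0)).
set theta := n%:R * u / _ in sum_q *; set eps := u / (1 + u) in round_q *.
have theta0 : 0 <= theta by rewrite divr_ge0 // addr_ge0.
have := ler_wpM2l theta0 (le_trans QS (lerD (lexx S) round_q)).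
by clear -split_err sum_q round_q; lra.
Qed.

End Grid.

Theorem corollary11 (R : realType) (beta mu : nat) (ea : int) (n : nat)
  (fl : 'I_n -> R -> R) (r : 'I_n.+1 -> R -> R) (x y : 'rV[R]_n.+1)
  (hbeta : (2 <= beta)%N) (hmu : (1 <= mu)%N) (hea : ea < - mu%:Z)
  (hn : (1 <= n)%N)
  (hfl : forall k, rounds_to_nearest (ieee_system R beta mu ea) (fl k))
  (hr : forall k, rounds_to_nearest (ieee_system R beta mu ea) (r k))
  (hu : 20 * n%:R * unit_roundoff R beta mu <= 1) :
  let u := unit_roundoff R beta mu in
  let a := alpha R beta ea in
  let err := `| Fl_dot fl r x y - \sum_(k < n.+1) x 0 k * y 0 k | in
  let Sxy := \sum_(k < n.+1) `| x 0 k * y 0 k | in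
  err <= 105 / 100 * (n%:R + 1) * (a / 2) + beta_coef n u * u * Sxy
  /\ (a <= u * Sxy -> err <= 3 / 2 * (n%:R + 1) * u * Sxy).
Proof.
move=> u a err Sxy.
have u0 : 0 < u by exact: u_gt0.
have a0 : 0 < a by exact: a_gt0.
have S0 : 0 <= Sxy by exact: sumr_ge0.
have nu0 : 0 <= n%:R * u by rewrite mulr_ge0 // ltW.
have nu20 : 20 * (n%:R * u) <= 1 by rewrite mulrA.
have nu2 : 2 * (n%:R * u) <= 1 by lra.
have main : err <= (1 + n%:R * u / (1 + n%:R * u)) * ((n%:R + 1) * (a / 2)) +
    beta_coef n u * u * Sxy.
  exact: (dot_error hbeta (fun k => x 0 k * y 0 k) nu2 hfl hr).
set theta := n%:R * u / (1 + n%:R * u) in main.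
have nu1 : 0 < 1 + n%:R * u by rewrite ltr_wpDr.
split.
- apply: le_trans main _; rewrite lerD2r -mulrA ler_wpM2r //.
    by rewrite mulr_ge0 ?divr_ge0 ?addr_ge0 // ltW.
  suff : theta <= 5 / 100 by lra.
  by rewrite /theta ler_pdivrMr //; lra.
- move=> aS; apply: le_trans main _.
  have := ler_wpM2r (mulr_ge0 (ltW u0) S0) (beta_coef_le hn (ltW u0)).
  have : (1 + theta) * ((n%:R + 1) * a) <= (1 + theta) * ((n%:R + 1) * (u * Sxy)).
    by rewrite !ler_wpM2l // addr_ge0 // divr_ge0 // ltW.
  by clear; rewrite -/theta; lra.
Qed.
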